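(* Let $K$ and $L$ be simplicial complexes of non-negative dimension on finite index sets $V$ and $W$, respectively. Assume that $\alpha=V\cap W$ is a common face of $K$ and $L$, and that $K\neq\Delta^V$ or $L\neq\Delta^W$. If $\alpha$ is neither a facet of $K$ nor a facet of $L$, then the Alexander dual $(K\cup_\alpha L)^*$ (taken with respect to the index set $V\cup W$) is Golod.
   Context: A simplicial complex $K$ on a finite index set $V$ is a family of subsets of $V$ closed under taking subsets and containing $\emptyset$; elements of $V$ that are not vertices of $K$ (ghost vertices) are allowed. A facet is a face maximal under inclusion. $\Delta^V$ is the full simplex on $V$. If $\alpha=V\cap W$ is a face of both $K$ and $L$, $K\cup_\alpha L$ is the simplicial complex $K\cup L$ on $V\cup W$ ($K$ and $L$ glued along $\alpha$). The Alexander dual of $K\ne\Delta^V$ is $K^*=\{\sigma\subset V\mid V\setminus\sigma\notin K\}$. Golod: for a complex $K$ on $[m]=\{1,\dots,m\}$ and a field $\mathbf{k}$, let $\mathbf{k}[K]=\mathbf{k}[v_1,\dots,v_m]/(v_{i_1}\cdots v_{i_k}\mid\{i_1,\dots,i_k\}\notin K)$ and let $\mathrm{Tor}^{\mathbf{k}[v_1,\dots,v_m]}(\mathbf{k}[K],\mathbf{k})=H(\Lambda[u_1,\dots,u_m]\otimes\mathbf{k}[K],d)$ be the homology of the Koszul differential graded algebra with $\deg u_i=(1,2)$, $\deg v_i=(0,2)$, $du_i=v_i$, $dv_i=0$. $K$ is Golod over $\mathbf{k}$ if the multiplication (of elements of positive degree) and all higher Massey products in this algebra are trivial; $K$ is Golod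 if it is Golod over every field. Massey products: write $\bar a=(-1)^{\deg a+1}a$. The $n$-fold Massey product $\langle a_1,\dots,a_n\rangle$ is the set of homology classes of elements $\bar a_{1,1}a_{2,n}+\bar a_{1,2}a_{3,n}+\cdots+\bar a_{1,n-1}a_{n,n}$ over all solutions of $a_i=[a_{i,i}]$ for $1\le i\le n$ and $da_{i,j}=\bar a_{i,i}a_{i+1,j}+\cdots+\bar a_{i,j-1}a_{j,j}$ for $1\le i<j\le n$, $(i,j)\ne(1,n)$. It is trivial if it contains zero. *)

(* Defs.v *)
From HB Require Import structures.
From mathcomp Require Import all_boot all_order all_algebra.
From mathcomp Require Import mpoly.

Set Implicit Arguments.
Unset Strict Implicit.
Unset Printing Implicit Defensive.

Import GRing.Theory Num.Theory.
Local Open Scope ring_scope.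

Section Complexes.
Variable T : finType.
Implicit Types (U V s t : {set T}) (K : {set {set T}}).

(* Elements of V need not be vertices of K (ghost vertices are allowed). *)
Definition simplicial_complex V K : Prop :=
  [/\ set0 \in K,
      forall s, s \in K -> s \subset V
    & forall s t, s \in K -> t \subset s -> t \in K].

(* complex_dim [set set0] = -1. *)
Definition complex_dim K : int := (\max_(s in K) #|s|)%:Z - 1.

Definition facet K s : bool := maxset (fun t => t \in K) s.

Definition full_simplex V : {set {set T}} := powerset V.

Definition alexander_dual U K : {set {set T}} :=
  [set s : {set T} | (s \subset U) && (U :\: s \notin K)].

(* Transport of a complex on U to {0, ..., #|U| - 1} along the bijection
   enum_val : 'I_#|U| -> U. *)
Definition relabel U K : {set {set 'I_#|U|}} :=
  [set s : {set 'I_#|U|} | [set enum_val i | i in s] \in K].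

End Complexes.

Section Koszul.
Variables (k : fieldType) (m : nat).

(* The algebra Lambda[u_1, ..., u_m] (x) k[v_1, ..., v_m]: the function x stands
   for the sum over A of x A * u_A, where u_A = u_{i_1} ... u_{i_p} for
   A = {i_1 < ... < i_p}, and v_i is the variable 'X_i. *)
Definition koszul : Type := {ffun {set 'I_m} -> {mpoly k[m]}}.
HB.instance Definition _ := GRing.Zmodule.on koszul.

Implicit Types (x y c : koszul) (A B : {set 'I_m}).

(* For disjoint A and B, u_A u_B = (-1) ^+ inversions A B * u_(A :|: B). *)
Definition inversions A B : nat :=
  #|[set ab : 'I_m * 'I_m | [&& ab.1 \in A, ab.2 \in B & (ab.2 < ab.1)%N]]|.

Definition kmul x y : koszul :=
  [ffun A : {set 'I_m} => \sum_(B : {set 'I_m} | B \subset A)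
     (-1) ^+ inversions B (A :\: B) * (x B * y (A :\: B))].

(* The derivation d (x y) = (d x) y + (-1)^(deg x) x (d y) with d u_i = v_i and
   d v_i = 0; thus d u_A is the sum over i in A of
   (-1) ^+ #|{j in A, j < i}| * v_i * u_(A :\ i). *)
Definition kd x : koszul :=
  [ffun A : {set 'I_m} => \sum_(i < m | i \notin A)
     (-1) ^+ #|[set j in A | (j < i)%N]| * ('X_i * x (i |: A))].

(* (-1)^(deg x + 1) x for x homogeneous.  Since deg u_i = (1, 2) and
   deg v_i = (0, 2), only the degree in the u_i contributes to the sign. *)
Definition kbar x : koszul := [ffun A : {set 'I_m} => (-1) ^+ #|A|.+1 * x A].

Variable K : {set {set 'I_m}}.

(* The ideal of k[v_1, ..., v_m] generated by the v_{i_1} ... v_{i_r} with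
   {i_1, ..., i_r} not in K. *)
Definition sr_ideal (f : {mpoly k[m]}) : Prop :=
  exists c : {set 'I_m} -> {mpoly k[m]},
    f = \sum_(s : {set 'I_m} | s \notin K) c s * \prod_(i in s) 'X_i.

(* Lambda[u_1, ..., u_m] (x) k[K] is the quotient of koszul by the congruence
   keq; all the notions below are those of this quotient. *)
Definition keq x y : Prop := forall A : {set 'I_m}, sr_ideal (x A - y A).

Definition khomog (p : nat) x : Prop :=
  forall A : {set 'I_m}, #|A| != p -> sr_ideal (x A).

Definition kcycle x : Prop := keq (kd x) 0.

Definition homologous x y : Prop := exists w : koszul, keq (x - y) (kd w).

Definition massey_term (a : nat -> nat -> koszul) (i j : nat) : koszul :=
  \sum_(i <= l < j) kmul (kbar (a i l)) (a l.+1 j).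

(* Solutions a_{i,j}, 1 <= i <= j <= n, (i, j) <> (1, n), for the classes of the
   cycles z_1, ..., z_n of degrees p_1, ..., p_n.  Since d lowers the degree by
   one, a_{i,j} has degree p_i + ... + p_j + (j - i). *)
Definition defining_system (n : nat) (p : nat -> nat) (z : nat -> koszul)
    (a : nat -> nat -> koszul) : Prop :=
  [/\ forall i, (1 <= i <= n)%N -> homologous (a i i) (z i),
      forall i j, (1 <= i)%N -> (i <= j)%N -> (j <= n)%N -> (i, j) != (1, n)%N ->
        khomog (\sum_(i <= l < j.+1) p l + (j - i))%N (a i j),
      forall i, (1 <= i <= n)%N -> kcycle (a i i)
    & forall i j, (1 <= i)%N -> (i < j)%N -> (j <= n)%N -> (i, j) != (1, n)%N ->
        keq (kd (a i j)) (massey_term a i j)].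

(* The cycle c represents an element of <[z_1], ..., [z_n]>. *)
Definition in_massey (n : nat) (p : nat -> nat) (z : nat -> koszul) c : Prop :=
  exists2 a, defining_system n p z a & homologous c (massey_term a 1 n).

(* Positive degree means positive degree in the u_i: the homology in degree 0
   is generated by the class of 1, because v_i = d u_i. *)
Definition golod_over : Prop :=
  (forall (p q : nat) (x y : koszul), (0 < p)%N -> (0 < q)%N ->
     khomog p x -> khomog q y -> kcycle x -> kcycle y ->
     homologous (kmul x y) 0) /\
  (forall (n : nat) (p : nat -> nat) (z : nat -> koszul), (3 <= n)%N ->
     (forall i, (1 <= i <= n)%N ->
        [/\ (0 < p i)%N, khomog (p i) (z i) & kcycle (z i)]) ->
     in_massey n p z 0).

End Koszul.

Definition golod (T : finType) (U : {set T}) (K : {set {set T}}) : Prop :=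
  forall k : fieldType, golod_over k (relabel U K).

(* Main.v *)
From HB Require Import structures.
Require Import Defs.
From mathcomp Require Import all_boot all_order all_algebra.
From mathcomp Require Import mpoly ring zify.

(** Let S be the polynomial ring on the vertex set V :|: W and let I be the
    Stanley-Reisner ideal of the dual of K :|: L.  A squarefree monomial lies in
    I exactly when the complement of its support is a face of K or of L, so with
    P = W :\: V and Q = V :\: W every element of I has the form
    x^P b1 + x^Q b2.  That alpha is a face of K but not a facet means that some
    a |: alpha with a in Q is a face, that is, x^P x^(Q - a) lies in I;
    similarly x^(P - b) x^Q lies in I for some b in P.  Put f1 = x^(P - b) and
    f2 = x^(Q - a), and write v, w for the indices of a, b.

    Every cycle of positive degree modulo I is homologous to a normal form
      f1 u_w y1 + f2 u_v y2 + f1 f2 u_w u_v g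
    in which y1 and y2 are cycles over S itself ([normal_decomposition]).  Indeed
    the differential of the cycle is x^P b1 + x^Q b2.  Differentiating once more
    gives x^P (d b1) = - x^Q (d b2); as x^P and x^Q are coprime, both sides are
    multiples of x^P x^Q, and this common multiple supplies g.  Correcting b1 and
    b2 by multiples of g makes them cycles y1 and y2, and then the normal form
    has the same differential as the given cycle.  Their difference is a cycle of
    the Koszul complex of S, which is exact ([koszul_exact]).

    Since u_w u_w = u_v u_v = 0, the product of two normal forms is
    f1 f2 u_w u_v t with t = +- y1 z2 +- y2 z1 a cycle over S
    ([normal_form_mul]).  Because V is not a face of K or W is not a face of L,
    all y1 or all y2 have vanishing constant term, so t = d c by exactness.
    Moreover x_v and x_w multiply f1 f2 into I, so modulo I the element
    f1 f2 u_w u_v c has differential f1 f2 u_w u_v t: products of normal forms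
    are boundaries ([normal_mul_boundary]).

    For a Massey product, normal forms on the diagonal, the elements
    f1 f2 u_w u_v c just above it, and 0 elsewhere form a defining system: the
    product of an element f1 f2 u_w u_v c with any normal form vanishes, as u_w or
    u_v is repeated in every term, so all conditions beyond the first
    off-diagonal read 0 = 0, and for n >= 3 the Massey product contains 0
    ([glue_massey]). *)

Set Implicit Arguments.
Unset Strict Implicit.
Unset Printing Implicit Defensive.

Import GRing.Theory.
Local Open Scope ring_scope.

(** * The Koszul algebra of a polynomial ring *)

Section KoszulAlgebra.
Variables (k : fieldType) (m : nat).
Implicit Types (x y z : koszul k m) (A B : {set 'I_m}) (i j : 'I_m).
Implicit Types (f g : {mpoly k[m]}).

Definition below i A : nat := #|[set j in A | (j < i)%N]|.

Definition kscale f x : koszul k m := [ffun A : {set 'I_m} => f * x A].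

(** Left multiplication by u_i.  Signs are only computed for this operation; the
    identities of the algebra follow by [koszul_ind]. *)
Definition ku i x : koszul k m :=
  [ffun A : {set 'I_m} =>
     if i \in A then (-1) ^+ below i A * x (A :\ i) else 0].

Lemma kuE i x A :
  ku i x A = if i \in A then (-1) ^+ below i A * x (A :\ i) else 0.
Proof. by rewrite ffunE. Qed.

Lemma kdE x A : kd x A =
  \sum_(i < m | i \notin A) (-1) ^+ below i A * ('X_i * x (i |: A)).
Proof. by rewrite ffunE. Qed.

Lemma kmulE x y A : kmul x y A = \sum_(B : {set 'I_m} | B \subset A)
     (-1) ^+ inversions B (A :\: B) * (x B * y (A :\: B)).
Proof. by rewrite ffunE. Qed.

Definition ksgn x : koszul k m := [ffun A : {set 'I_m} => (-1) ^+ #|A| * x A].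

Definition kpart p x : koszul k m :=
  [ffun A : {set 'I_m} => if #|A| == p then x A else 0].

Definition kone : koszul k m := [ffun A : {set 'I_m} => (A == set0)%:R].

Lemma kaddE x y A : (x + y) A = x A + y A.
Proof. by rewrite ffunE. Qed.

Lemma koppE x A : (- x) A = - x A.
Proof. by rewrite ffunE. Qed.

Lemma kzeroE A : (0 : koszul k m) A = 0.
Proof. by rewrite ffunE. Qed.

Definition kE := (kaddE, koppE, kzeroE).

Lemma ksumE I (r : seq I) (P : pred I) (F : I -> koszul k m) A :
  (\sum_(i <- r | P i) F i) A = \sum_(i <- r | P i) F i A.
Proof. by elim/big_rec2: _ => [|i u v _ <-]; rewrite kE. Qed.

Lemma kscale_is_zmod_morphism f : zmod_morphism (kscale f).
Proof. by move=> x y; apply/ffunP => A; rewrite !(kE, ffunE) mulrBr. Qed.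
HB.instance Definition _ f := GRing.isZmodMorphism.Build _ _ (kscale f)
  (kscale_is_zmod_morphism f).

Lemma ku_is_zmod_morphism i : zmod_morphism (ku i).
Proof.
move=> x y; apply/ffunP => A; rewrite !(kE, ffunE).
by case: ifP => _; rewrite ?subr0 // mulrBr.
Qed.
HB.instance Definition _ i := GRing.isZmodMorphism.Build _ _ (ku i)
  (ku_is_zmod_morphism i).

Lemma ksgn_is_zmod_morphism : zmod_morphism ksgn.
Proof. by move=> x y; apply/ffunP => A; rewrite !(kE, ffunE) mulrBr. Qed.
HB.instance Definition _ := GRing.isZmodMorphism.Build _ _ ksgn
  ksgn_is_zmod_morphism.

Lemma kpart_is_zmod_morphism p : zmod_morphism (kpart p).
Proof.
move=> x y; apply/ffunP => A; rewrite !(kE, ffunE).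
by case: ifP => _; rewrite ?subr0.
Qed.
HB.instance Definition _ p := GRing.isZmodMorphism.Build _ _ (kpart p)
  (kpart_is_zmod_morphism p).

Lemma kd_is_zmod_morphism : zmod_morphism (@kd k m).
Proof.
move=> x y; apply/ffunP => A; rewrite !(kE, ffunE) -sumrB.
by apply: eq_bigr => i _; rewrite !kE; ring.
Qed.
HB.instance Definition _ := GRing.isZmodMorphism.Build _ _ (@kd k m)
  kd_is_zmod_morphism.

Lemma kmul_is_zmod_morphism x : zmod_morphism (kmul x).
Proof.
move=> y z; apply/ffunP => A; rewrite !(kE, ffunE) -sumrB.
by apply: eq_bigr => i _; rewrite !kE; ring.
Qed.
HB.instance Definition _ x := GRing.isZmodMorphism.Build _ _ (kmul x)
  (kmul_is_zmod_morphism x).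

Lemma kmulDl x y z : kmul (x + y) z = kmul x z + kmul y z.
Proof.
apply/ffunP => A; rewrite !(kE, ffunE) -big_split.
by apply: eq_bigr => i _; rewrite !kE /=; ring.
Qed.

Lemma kscaleA f g x : kscale f (kscale g x) = kscale (f * g) x.
Proof. by apply/ffunP => A; rewrite !ffunE mulrA. Qed.

Lemma kscaleC f g x : kscale f (kscale g x) = kscale g (kscale f x).
Proof. by rewrite !kscaleA mulrC. Qed.

Lemma kscale0 x : kscale 0 x = 0.
Proof. by apply/ffunP => A; rewrite !ffunE mul0r. Qed.

Lemma kscaleI f : f != 0 -> injective (kscale f).
Proof.
move=> f0 x y /ffunP e; apply/ffunP => A; move: (e A); rewrite !ffunE.
exact: mulfI.
Qed.

Lemma ku_scale i f x : ku i (kscale f x) = kscale f (ku i x).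
Proof.
by apply/ffunP => A; rewrite !ffunE; case: ifP => _; rewrite ?mulr0 // mulrCA.
Qed.

Lemma kd_scale f x : kd (kscale f x) = kscale f (kd x).
Proof.
apply/ffunP => A; rewrite !ffunE mulr_sumr.
by apply: eq_bigr => i _; rewrite ffunE; ring.
Qed.

Lemma ksgn_scale f x : ksgn (kscale f x) = kscale f (ksgn x).
Proof. by apply/ffunP => A; rewrite !ffunE mulrCA. Qed.

Lemma kpart_scale p f x : kpart p (kscale f x) = kscale f (kpart p x).
Proof. by apply/ffunP => A; rewrite !ffunE; case: ifP; rewrite ?mulr0. Qed.

Lemma kmul_scalel f x y : kmul (kscale f x) y = kscale f (kmul x y).
Proof.
apply/ffunP => A; rewrite !ffunE mulr_sumr.
by apply: eq_bigr => i _; rewrite ffunE; ring.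
Qed.

Lemma kmul_scaler f x y : kmul x (kscale f y) = kscale f (kmul x y).
Proof.
apply/ffunP => A; rewrite !ffunE mulr_sumr.
by apply: eq_bigr => i _; rewrite ffunE; ring.
Qed.

Lemma kmul0l x : kmul 0 x = 0.
Proof.
by apply/ffunP => A; rewrite !ffunE big1 // => B _; rewrite kE mul0r mulr0.
Qed.

Lemma kmulNl x y : kmul (- x) y = - kmul x y.
Proof. by apply/eqP; rewrite -addr_eq0 -kmulDl addNr kmul0l. Qed.

Lemma kbarE x : kbar x = - ksgn x.
Proof. by apply/ffunP => A; rewrite !(kE, ffunE) exprS mulN1r mulNr. Qed.

Lemma below_setU1 i j A : j \notin A -> below i (j |: A) = ((j < i) + below i A)%N.
Proof.
move=> jA; rewrite /below; case: (ltnP j i) => ji.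
  rewrite [RHS](_ : _ = #|j |: [set l in A | (l < i)%N]|); last first.
    by rewrite cardsU1 inE (negPf jA).
  by apply: eq_card => l; rewrite !inE; case: eqP => [->|].
rewrite add0n; apply: eq_card => l; rewrite !inE.
by case: eqP => [->|]; rewrite ?(negPf jA) // ltnNge ji.
Qed.

Lemma below_setD1 i j A : j \in A -> below i A = ((j < i) + below i (A :\ j))%N.
Proof. by move=> jA; rewrite -{1}(setD1K jA) below_setU1 // !inE eqxx. Qed.

(** Moving u_i past u_j changes exactly one of the two position counts. *)
Lemma ku_ku i j x : ku i (ku j x) = - ku j (ku i x).
Proof.
apply/ffunP => A; rewrite !(kE, ffunE) !inE.
have [->|ij] /= := eqVneq i j.
  by case: ifP; rewrite ?mulr0 ?oppr0.
case: (boolP (i \in A)) => iA; case: (boolP (j \in A)) => jA;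
  rewrite ?mulr0 ?oppr0 //=.
rewrite (below_setD1 i jA) (below_setD1 j iA) setDDl setUC -setDDl !exprD.
have: ((j < i) (+) (i < j))%N by case: ltngtP ij => // /val_inj ->; rewrite eqxx.
by case: (j < i)%N; case: (i < j)%N => // _; rewrite ?expr0 ?expr1; ring.
Qed.

Lemma kuu i x : ku i (ku i x) = 0.
Proof. by apply/ffunP => A; rewrite !(kE, ffunE) !inE eqxx mulr0 if_same. Qed.

(** The Leibniz rule for u_i x; it determines d, since the elements u_i generate
    the algebra. *)
Lemma kd_ku i x : kd (ku i x) = kscale 'X_i x - ku i (kd x).
Proof.
apply/ffunP => A; rewrite !kE kdE kuE ffunE.
case: (boolP (i \in A)) => iA; last first.
  rewrite subr0 (bigD1 i) //= big1 ?addr0 => [|j /andP[jA ji]].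
    by rewrite kuE !inE eqxx /= setU1K // below_setU1 // ltnn ['X_i * _]mulrCA signrMK.
  by rewrite kuE !inE (negPf iA) eq_sym (negPf ji) /= !mulr0.
rewrite kdE [X in _ = _ - _ * X](bigD1 i) ?inE ?eqxx //= setD1K //.
rewrite (below_setD1 i iA) ltnn add0n.
rewrite mulrDr signrMK opprD addrA addrN add0r mulr_sumr -sumrN.
apply: eq_big => [j|j jA].
  by rewrite !inE; case: eqP => [->|]; rewrite ?iA ?andbF ?andbT.
have ji : j != i by apply: contraNneq jA => ->.
rewrite kuE !inE iA orbT; have -> : (j |: A) :\ i = j |: A :\ i.
  by apply/setP => l; rewrite !inE; case: (eqVneq l j) => [->|//]; rewrite ji.
rewrite below_setU1 // (below_setD1 i iA) ltnn add0n (below_setD1 j iA).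
have: ((j < i) (+) (i < j))%N by case: ltngtP ji => // /val_inj ->; rewrite eqxx.
rewrite !exprD.
by case: (j < i)%N; case: (i < j)%N => // _; rewrite ?expr0 ?expr1; ring.
Qed.

Lemma below_setD i A B : B \subset A ->
  below i A = (below i B + below i (A :\: B))%N.
Proof.
move=> sBA; rewrite /below -(cardsID B); congr (_ + _)%N; apply: eq_card => j.
  by rewrite !inE; case: (boolP (j \in B)) => [/(subsetP sBA) ->|]; rewrite ?andbT ?andbF.
by rewrite !inE andbA.
Qed.

Lemma inversions_setU1 i A B : i \notin A ->
  inversions (i |: A) B = (below i B + inversions A B)%N.
Proof.
move=> iA; rewrite /inversions.
rewrite -(cardsID [set ab : 'I_m * 'I_m | ab.1 == i]); congr (_ + _)%N.
  rewrite /below -(card_imset _ (can_inj (fun j => erefl : (i, j).2 = j))).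
  apply: eq_card => -[a b]; rewrite !inE /=; apply/idP/imsetP.
    case/andP => /and3P[_ bB ba] /eqP ai; exists b; last by rewrite ai.
    by rewrite inE bB -ai.
  by case=> j; rewrite inE => /andP[jB ji] [-> ->]; rewrite eqxx jB ji.
apply: eq_card => -[a b]; rewrite !inE /=.
by case: eqP => [->|]; rewrite ?(negPf iA).
Qed.

Lemma kmul_ku_l i x y : kmul (ku i x) y = ku i (kmul x y).
Proof.
apply/ffunP => A; rewrite kmulE kuE; case: ifP => iA; last first.
  rewrite big1 // => B /subsetP sBA; rewrite kuE ifN ?mul0r ?mulr0 //.
  by apply: contraFN iA => /sBA.
rewrite (bigID (fun B => i \in B)) /= [X in _ + X]big1 ?addr0; last first.
  by move=> B /andP[_ iB]; rewrite kuE (negPf iB) mul0r mulr0.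
rewrite kmulE mulr_sumr.
rewrite (reindex_onto (fun B => i |: B) (fun B => B :\ i)) /=; last first.
  by move=> B /andP[_ iB]; rewrite setD1K.
apply: eq_big => [B|B].
  rewrite subUset sub1set iA !inE eqxx andbT subsetD1 /=; congr (_ && _).
  apply/eqP/idP => [<-|iB]; last by rewrite setU1K.
  by rewrite !inE eqxx.
case/andP => /andP[]; rewrite subUset sub1set iA /= => sBA _ /eqP iB.
have {}iB : i \notin B by rewrite -iB !inE eqxx.
rewrite kuE !inE eqxx /= setU1K //.
rewrite (_ : A :\: (i |: B) = (A :\ i) :\: B); last by rewrite setDDl.
rewrite inversions_setU1 // (below_setD1 i iA) ltnn below_setU1 // ltnn.
rewrite (@below_setD i (A :\ i) B) ?subsetD1 ?sBA //.
by rewrite !exprD; ring.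
Qed.

Lemma kmul1 x : kmul kone x = x.
Proof.
apply/ffunP => A; rewrite kmulE (bigD1 set0) ?sub0set //= big1 => [|B /andP[_ B0]].
  rewrite !ffunE eqxx mul1r setD0 addr0 /inversions.
  rewrite (_ : [set _ | _] = set0) ?cards0 ?expr0 ?mul1r //.
  by apply/setP => -[a b]; rewrite !inE.
by rewrite !ffunE (negPf B0) mul0r mulr0.
Qed.

(** Every element is a combination of products of the u_i, so a property that is
    stable under sums, scalars and left multiplication by each u_i need only be
    checked at 1. *)
Lemma koszul_ind (Pr : koszul k m -> Prop) :
  Pr kone -> (forall x y, Pr x -> Pr y -> Pr (x + y)) ->
  (forall f x, Pr x -> Pr (kscale f x)) ->
  (forall i x, Pr x -> Pr (ku i x)) -> forall x, Pr x.
Proof.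
move=> P1 PD PZ Pu x; have P0 : Pr 0 by rewrite -(kscale0 kone); apply: PZ.
pose delta A : koszul k m := [ffun B : {set 'I_m} => (B == A)%:R].
have -> : x = \sum_A kscale (x A) (delta A).
  apply/ffunP => B; rewrite ksumE (bigD1 B) //= big1 => [|A AB].
    by rewrite !ffunE eqxx mulr1 addr0.
  by rewrite !ffunE eq_sym (negPf AB) mulr0.
apply: (big_ind Pr) => // A _; apply: (PZ).
elim: {A}#|A| {-2}A (erefl #|A|) => [|n IH] A.
  by move/eqP; rewrite cards_eq0 => /eqP ->.
move=> cA; have [i iA] : exists i, i \in A by apply/card_gt0P; rewrite cA.
have -> : delta A = kscale ((-1) ^+ below i A) (ku i (delta (A :\ i))).
  apply/ffunP => B; rewrite !ffunE; case: (boolP (i \in B)) => iB.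
    have -> : (B :\ i == A :\ i) = (B == A).
      apply/eqP/eqP => [e|->//]; by rewrite -(setD1K iB) e setD1K.
    by case: eqP => [->|_]; rewrite ?mulr0 // mulr1 -expr2 sqrr_sign.
  by rewrite mulr0; case: eqP => // e; rewrite e iA in iB.
apply: PZ; apply: Pu; apply: IH; apply/eqP; rewrite -eqSS -cA (cardsD1 i A) iA.
by [].
Qed.

Lemma ksgn_ku i x : ksgn (ku i x) = - ku i (ksgn x).
Proof.
apply/ffunP => A; rewrite !(kE, ffunE); case: ifP => iA; last first.
  by rewrite mulr0 oppr0.
by rewrite (cardsD1 i A) iA exprS; ring.
Qed.

Lemma ksgn1 : ksgn kone = kone.
Proof.
apply/ffunP => A; rewrite !ffunE.
by case: eqP => [->|_]; rewrite ?mulr0 // cards0 mulr1.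
Qed.

Lemma ksgnK x : ksgn (ksgn x) = x.
Proof. by apply/ffunP => A; rewrite !ffunE signrMK. Qed.

Lemma kd1 : kd kone = 0.
Proof.
apply/ffunP => A; rewrite kdE kE big1 // => i iA; rewrite ffunE.
by rewrite setU_eq0 -cards_eq0 cards1 /= !mulr0.
Qed.

(** Passing u_i to the front of x y costs one sign for each factor u_j of x. *)
Lemma kmul_ku_r i x y : kmul x (ku i y) = ku i (kmul (ksgn x) y).
Proof.
elim/koszul_ind: x => [|x1 x2 IH1 IH2|f x IH|j x IH].
- by rewrite ksgn1 !kmul1.
- by rewrite raddfD /= !kmulDl raddfD /= IH1 IH2.
- by rewrite ksgn_scale !kmul_scalel ku_scale IH.
- by rewrite ksgn_ku kmulNl raddfN /= !kmul_ku_l IH ku_ku.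
Qed.

Lemma kdd x : kd (kd x) = 0.
Proof.
elim/koszul_ind: x => [|x1 x2 IH1 IH2|f x IH|j x IH].
- by rewrite kd1 raddf0.
- by rewrite !raddfD /= IH1 IH2 addr0.
- by rewrite !kd_scale IH raddf0.
- by rewrite kd_ku raddfB /= kd_scale kd_ku IH raddf0 subr0 subrr.
Qed.

Lemma kd_mul x y : kd (kmul x y) = kmul (kd x) y + kmul (ksgn x) (kd y).
Proof.
elim/koszul_ind: x => [|x1 x2 IH1 IH2|f x IH|j x IH].
- by rewrite kmul1 kd1 kmul0l ksgn1 kmul1 add0r.
- by rewrite kmulDl !raddfD /= !kmulDl IH1 IH2 addrACA.
- by rewrite kmul_scalel !kd_scale ksgn_scale !kmul_scalel IH raddfD.
- rewrite kmul_ku_l !kd_ku IH kmulDl kmulNl kmul_scalel kmul_ku_l ksgn_ku kmulNl.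
  by rewrite kmul_ku_l raddfD /= opprD addrA.
Qed.

Lemma kd_ksgn x : kd (ksgn x) = - ksgn (kd x).
Proof.
elim/koszul_ind: x => [|x1 x2 IH1 IH2|f x IH|j x IH].
- by rewrite ksgn1 kd1 raddf0 oppr0.
- by rewrite !raddfD /= IH1 IH2.
- by rewrite ksgn_scale !kd_scale ksgn_scale IH raddfN.
- rewrite ksgn_ku raddfN /= !kd_ku IH [ksgn (_ - _)]raddfB /=.
  rewrite ksgn_scale ksgn_ku !raddfN /=.
  by rewrite !opprK.
Qed.

Lemma kpart_ku p i x : kpart p.+1 (ku i x) = ku i (kpart p x).
Proof.
apply/ffunP => A; rewrite !(kE, ffunE); case: (boolP (i \in A)) => iA.
  by rewrite (cardsD1 i A) iA eqSS; case: eqP; rewrite ?mulr0.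
by rewrite if_same.
Qed.

(** The differential lowers the degree in the u_i by one. *)
Lemma kd_kpart p x : kd (kpart p.+1 x) = kpart p (kd x).
Proof.
apply/ffunP => A; rewrite kdE ffunE kdE; case: eqP => Ap.
  by apply: eq_bigr => i iA; rewrite ffunE cardsU1 iA Ap eqxx.
rewrite big1 // => i iA; rewrite ffunE cardsU1 iA eqSS.
by case: eqP => // _; rewrite !mulr0.
Qed.

Lemma kpartK p x : kpart p (kpart p x) = kpart p x.
Proof. by apply/ffunP => A; rewrite !ffunE; case: eqP. Qed.

Lemma kmul_kpart p q x y :
  kpart (p + q) (kmul (kpart p x) (kpart q y)) = kmul (kpart p x) (kpart q y).
Proof.
apply/ffunP => A; rewrite ffunE; case: eqP => // Apq; rewrite kmulE big1 // => B sBA.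
rewrite !ffunE; case: eqP => [Bp|]; last by rewrite mul0r mulr0.
case: eqP => [ABq|]; last by rewrite !mulr0.
by case: Apq; rewrite -Bp -ABq -(cardsID B A) (setIidPr sBA).
Qed.

(** * Exactness of the Koszul complex *)

(** Substitution of 0 for the variables indexed by B; [zeroing setT] is the
    constant term. *)
Definition zeroing B : {mpoly k[m]} -> {mpoly k[m]} :=
  comp_mpoly [tuple if j \in B then 0 else 'X_j | j < m].
HB.instance Definition _ B := GRing.LRMorphism.on (zeroing B).

Lemma zeroingX B i : zeroing B 'X_i = if i \in B then 0 else 'X_i.
Proof. by rewrite /zeroing comp_mpolyXU -tnth_nth tnth_mktuple. Qed.

Lemma zeroing_comp B1 B2 p : zeroing B1 (zeroing B2 p) = zeroing (B1 :|: B2) p.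
Proof.
rewrite [zeroing B2 p]comp_mpolyE [RHS]comp_mpolyE raddf_sum.
apply: eq_bigr => mm _; rewrite /= linearZ /=; congr (_ *: _).
rewrite rmorph_prod; apply: eq_bigr => i _; rewrite /= rmorphXn !tnth_mktuple.
congr (_ ^+ _); rewrite inE; case: (i \in B2); rewrite ?rmorph0 ?orbT // orbF.
exact: zeroingX.
Qed.

Lemma zeroing_set0 p : zeroing set0 p = p.
Proof.
rewrite /zeroing -[RHS]comp_mpoly_id; congr (_ \mPo _).
by apply: eq_from_tnth => i; rewrite !tnth_mktuple inE.
Qed.

Lemma zeroing_divX i p : exists q, p = zeroing [set i] p + 'X_i * q.
Proof.
have X j : exists q, ('X_j : {mpoly k[m]}) = zeroing [set i] 'X_j + 'X_i * q.
  rewrite zeroingX inE; case: eqP => [->|_]; last by exists 0; rewrite mulr0 addr0.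
  by exists 1; rewrite mulr1 add0r.
have M p1 p2 : (exists q, p1 = zeroing [set i] p1 + 'X_i * q) ->
  (exists q, p2 = zeroing [set i] p2 + 'X_i * q) ->
  exists q, p1 * p2 = zeroing [set i] (p1 * p2) + 'X_i * q.
  move=> [q1 e1] [q2 e2]; exists (zeroing [set i] p1 * q2 + q1 * p2).
  by rewrite rmorphM /= {1}e1 {1}e2 [in X in _ = _ + X]e2; ring.
have one : exists q, (1 : {mpoly k[m]}) = zeroing [set i] 1 + 'X_i * q.
  by exists 0; rewrite rmorph1 mulr0 addr0.
elim/mpolyind: p => [|c mm p _ _ [q e]].
  by exists 0; rewrite rmorph0 mulr0 addr0.
have [q' e'] : exists q, 'X_[mm] = zeroing [set i] 'X_[mm] + 'X_i * q.
  rewrite mpolyXE_id; elim/big_ind: _ => // j _.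
  by elim: (mm j) => [|a IH]; rewrite ?expr0 // exprS; apply: M.
exists (c *: q' + q).
rewrite {1}e {1}e' [zeroing _ (_ + p)]rmorphD /= [zeroing _ (c *: _)]linearZ /=.
rewrite -!mul_mpolyC; ring.
Qed.

Lemma zeroing_eq0_dvdX i p : zeroing [set i] p = 0 -> exists q, p = 'X_i * q.
Proof. by move=> e; have [q] := zeroing_divX i p; rewrite e add0r; exists q. Qed.

Lemma mpolyX_neq0 i : ('X_i : {mpoly k[m]}) != 0.
Proof. by rewrite -msupp_eq0 msuppX. Qed.

(** A cycle becomes independent of the index i after subtracting a boundary.
    Write y = y0 + u_i y1 with no u_i in y0 and y1, and y0 = z + x_i q where x_i
    does not occur in z.  Then d y = 0 forces d z = 0 and d q = - y1, so that
    d (u_i q) = x_i q + u_i y1 = y - z. *)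
Lemma koszul_eliminate i y : kd y = 0 -> exists w,
  forall A, y A = kd w A + (if i \in A then 0 else zeroing [set i] (y A)).
Proof.
move=> dy.
have /fin_all_exists[q qE] : forall A, exists q, y A = zeroing [set i] (y A) + 'X_i * q.
  by move=> A; apply: zeroing_divX.
(* Only the part of the quotient q without u_i enters the primitive u_i q'. *)
pose q' : koszul k m := [ffun A : {set 'I_m} => if i \in A then 0 else q A].
exists (ku i q') => A; rewrite kd_ku !kE ffunE kuE ffunE.
case: (boolP (i \in A)) => iA; last by rewrite {1}qE subr0 addrC.
rewrite mulr0 addr0 add0r; set A' := A :\ i.
have iA' : i \notin A' by rewrite !inE eqxx.
have e : kd y A' = 0 by rewrite dy kE.
(* Subtract from the equation e its image under x_i := 0: what is left is
   divisible by x_i. *)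
rewrite kdE (bigD1 i) //= setD1K // in e.
have := congr1 (zeroing [set i]) e.
rewrite rmorph0 rmorphD /= !rmorphM /= zeroingX inE eqxx mul0r mulr0 add0r => e2.
have -> : below i A = below i A' by rewrite (below_setD1 i iA) ltnn.
suff h : 'X_i * ((-1) ^+ below i A' * y A + kd q' A') = 0.
  move/eqP: h; rewrite mulf_eq0 (negPf (mpolyX_neq0 i)) /= addr_eq0 => /eqP h.
  by rewrite -mulrN -h signrMK.
rewrite mulrDr mulrCA.
rewrite -[RHS]e; congr (_ + _).
rewrite -[RHS]subr0 -[X in _ = _ - X]e2 rmorph_sum -sumrB.
rewrite kdE (bigD1 i) //= ffunE !inE eqxx !mulr0 add0r mulr_sumr.
apply: eq_bigr => j /andP[jA ji].
rewrite !rmorphM /= rmorphXn rmorphN rmorph1 zeroingX !inE (negPf ji).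
rewrite ffunE !inE eq_sym (negPf ji) eqxx /= {1}(qE (j |: A')); ring.
Qed.

(** Eliminating all indices leaves the constant term of the coefficient of 1. *)
Lemma koszul_exact y : kd y = 0 -> zeroing setT (y set0) = 0 ->
  exists w, y = kd w.
Proof.
move=> dy y0.
have H (s : seq 'I_m) : exists w z, [/\ y = kd w + z,
   forall A i, i \in A -> i \in s -> z A = 0 &
   z set0 = zeroing [set i in s] (y set0)].
  elim: s => [|i s [w [z [e zA z0]]]].
    exists 0, y; split=> //; first by rewrite raddf0 add0r.
    by rewrite (_ : [set i in [::]] = set0) ?zeroing_set0.
  have dz : kd z = 0 by move: dy; rewrite {1}e raddfD /= kdd add0r.
  have [w' e'] := koszul_eliminate i dz.
  exists (w + w').
  exists [ffun A : {set 'I_m} => if i \in A then 0 else zeroing [set i] (z A)].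
  split.
  - rewrite raddfD /= e -addrA; congr (_ + _); apply/ffunP => A.
    by rewrite kE [X in _ + X]ffunE -e'.
  - move=> A j jA; rewrite inE ffunE => /orP[/eqP <-|js]; first by rewrite jA.
    by rewrite (zA A j) // rmorph0 if_same.
  - rewrite ffunE inE z0 zeroing_comp; congr zeroing.
    by apply/setP => j; rewrite !inE.
have [w [z [e zA z0]]] := H (enum 'I_m); exists w.
rewrite e [X in _ + X](_ : z = 0) ?addr0 //; apply/ffunP => A; rewrite kE.
have [->|[i iA]] := set_0Vmem A; last by rewrite (zA A i) // mem_enum.
rewrite z0 (_ : [set i in enum 'I_m] = setT) //.
by apply/setP => i; rewrite !inE mem_enum.
Qed.

Lemma kd_kpart0 x : kd (kpart 0 x) = 0.
Proof.
apply/ffunP => A; rewrite kdE kE big1 // => i iA.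
by rewrite ffunE cardsU1 iA !mulr0.
Qed.

Lemma kd_kpart_cycle p x : kd x = 0 -> kd (kpart p x) = 0.
Proof.
by case: p => [|p] dx; rewrite ?kd_kpart0 // kd_kpart dx raddf0.
Qed.

Lemma kbar_ku i x : kbar (ku i x) = ku i (ksgn x).
Proof. by rewrite kbarE ksgn_ku opprK. Qed.

Lemma ku_iji i j x : ku i (ku j (ku i x)) = 0.
Proof. by rewrite (ku_ku j) raddfN /= kuu oppr0. Qed.

Lemma kbar_kpart p x : kbar (kpart p x) = kpart p (kbar x).
Proof. by apply/ffunP => A; rewrite !ffunE; case: ifP; rewrite ?mulr0. Qed.

Definition mono A : {mpoly k[m]} := \prod_(i in A) 'X_i.

Lemma mono_neq0 A : mono A != 0.
Proof. by apply/prodf_neq0 => i _; apply: mpolyX_neq0. Qed.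

Lemma monoD1 i A : i \in A -> mono A = 'X_i * mono (A :\ i).
Proof. by move=> iA; rewrite /mono (big_setD1 i). Qed.

Lemma monoU A B : [disjoint A & B] -> mono (A :|: B) = mono A * mono B.
Proof.
by move=> dAB; rewrite /mono -bigU //; apply: eq_bigl => i; rewrite !inE.
Qed.

Lemma zeroing_mono B A : [disjoint A & B] -> zeroing B (mono A) = mono A.
Proof.
move=> dAB; rewrite /mono rmorph_prod; apply: eq_bigr => i iA.
by rewrite /= zeroingX (disjointFr dAB iA).
Qed.

Lemma zeroing_mono_eq0 A : A != set0 -> zeroing setT (mono A) = 0.
Proof.
case/set0Pn => i iA; rewrite (monoD1 iA) rmorphM /= zeroingX inE.
exact: mul0r.
Qed.

(** * The Stanley-Reisner ideal and its extension to the Koszul algebra *)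

(** Coprime monomials: the variables of B are divided out one by one, each
    being prime and not dividing the monomial of A. *)
Lemma mono_coprime A B f g : [disjoint A & B] ->
  mono A * f = mono B * g -> exists h, f = mono B * h.
Proof.
elim: {B}#|B| {-2}B (erefl #|B|) f g => [|n IH] B.
  by move=> /cards0_eq -> f _ _ _; exists f; rewrite /mono big_set0 mul1r.
move=> cB f g dAB; have [i iB] : exists i, i \in B by apply/card_gt0P; rewrite cB.
rewrite (monoD1 iB) => e.
have iA : i \notin A by rewrite (disjointFl dAB).
have dAi : [disjoint A & [set i]] by rewrite disjoint_sym disjoints1.
have [|f1 ef] := @zeroing_eq0_dvdX i f.
  have := congr1 (zeroing [set i]) e; rewrite !rmorphM /=.
  rewrite zeroing_mono // zeroingX inE eqxx.
  by rewrite !mul0r => /eqP; rewrite mulf_eq0 (negPf (mono_neq0 _)) => /eqP.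
have [|||h eh] := IH (B :\ i) _ f1 g.
- by apply/eqP; rewrite -eqSS -cB (cardsD1 i B) iB.
- by apply: disjointWr dAB; rewrite subD1set.
- by apply: (mulfI (mpolyX_neq0 i)); rewrite [RHS]mulrA -e ef; ring.
by exists h; rewrite ef eh mulrA.
Qed.

Section Ideal.
Variable C : {set {set 'I_m}}.

Lemma sr_ideal_mono f A : A \notin C -> sr_ideal C (f * mono A).
Proof.
move=> AC; exists (fun B => if B == A then f else 0).
rewrite (bigD1 A) //= eqxx [X in _ + X]big1 ?addr0 // => B /andP[_ /negPf ->].
by rewrite mul0r.
Qed.

Lemma sr_idealD f g : sr_ideal C f -> sr_ideal C g -> sr_ideal C (f + g).
Proof.
move=> [c ->] [d ->]; exists (fun A => c A + d A); rewrite -big_split.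
by apply: eq_bigr => A _; rewrite mulrDl.
Qed.

Lemma sr_idealM f g : sr_ideal C g -> sr_ideal C (f * g).
Proof.
move=> [c ->]; exists (fun A => f * c A); rewrite mulr_sumr.
by apply: eq_bigr => A _; rewrite mulrA.
Qed.

Lemma sr_ideal0 : sr_ideal C (0 : {mpoly k[m]}).
Proof. by exists (fun _ => 0); rewrite big1 // => A _; rewrite mul0r. Qed.

Lemma sr_idealN f : sr_ideal C f -> sr_ideal C (- f).
Proof. by rewrite -mulN1r; apply: sr_idealM. Qed.

Lemma sr_ideal_sum I (r : seq I) (Q : pred I) (F : I -> {mpoly k[m]}) :
  (forall t, Q t -> sr_ideal C (F t)) -> sr_ideal C (\sum_(i <- r | Q i) F i).
Proof. by move=> h; apply: big_ind => //; [apply: sr_ideal0|apply: sr_idealD]. Qed.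

(** The kernel of the projection from the Koszul algebra of the polynomial ring
    to that of the Stanley-Reisner ring. *)
Definition kideal x : Prop := forall A, sr_ideal C (x A).

Lemma kidealD x y : kideal x -> kideal y -> kideal (x + y).
Proof. by move=> hx hy A; rewrite kE; apply: sr_idealD. Qed.

Lemma kidealN x : kideal x -> kideal (- x).
Proof. by move=> hx A; rewrite kE; apply: sr_idealN. Qed.

Lemma kidealB x y : kideal x -> kideal y -> kideal (x - y).
Proof. by move=> hx hy; apply: kidealD => //; apply: kidealN. Qed.

Lemma kideal0 : kideal 0.
Proof. by move=> A; rewrite kE; apply: sr_ideal0. Qed.

Lemma kideal_scale f x : sr_ideal C f -> kideal (kscale f x).
Proof. by move=> hf A; rewrite ffunE mulrC; apply: sr_idealM. Qed.

Lemma kideal_kd x : kideal x -> kideal (kd x).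
Proof.
move=> hx A; rewrite kdE; apply: sr_ideal_sum => i _.
by do 2!apply: sr_idealM.
Qed.

Lemma kideal_ksgn x : kideal x -> kideal (ksgn x).
Proof. by move=> hx A; rewrite ffunE; apply: sr_idealM. Qed.

Lemma kideal_kpart p x : kideal x -> kideal (kpart p x).
Proof. by move=> hx A; rewrite ffunE; case: ifP => // _; apply: sr_ideal0. Qed.

Lemma kideal_mulr x y : kideal y -> kideal (kmul x y).
Proof.
move=> hy A; rewrite kmulE; apply: sr_ideal_sum => B _.
by do 2!apply: sr_idealM.
Qed.

Lemma kideal_mull x y : kideal x -> kideal (kmul x y).
Proof.
move=> hx A; rewrite kmulE; apply: sr_ideal_sum => B _.
by apply: sr_idealM; rewrite mulrC; apply: sr_idealM.
Qed.

Lemma keqP x y : keq C x y <-> kideal (x - y).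
Proof. by split=> h A; move: (h A); rewrite !kE. Qed.

Lemma khomog_kpart p x : khomog C p x <-> kideal (x - kpart p x).
Proof.
split=> h A; move: (h A); rewrite !kE ffunE.
  by case: eqP => [_ _|_]; rewrite ?subrr ?subr0; [apply: sr_ideal0|apply].
by case: eqP => // _; rewrite subr0.
Qed.

End Ideal.

End KoszulAlgebra.

(** * Cycles modulo a glued ideal *)

Section Glue.
Variables (k : fieldType) (m : nat).
Implicit Types (x y z : koszul k m) (f : {mpoly k[m]}) (A B : {set 'I_m}).
Variables (C F1 F2 : {set {set 'I_m}}) (P Q : {set 'I_m}) (v w : 'I_m).
(** F1 and F2 consist of the complements of the faces of K and of L, and P and Q
    of the indices of W :\: V and V :\: W.  The hypotheses on v and w say that the
    common face is a facet of neither complex, and [proper] says that K or L is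
    not a full simplex. *)
Hypothesis nonface : forall A, (A \notin C) = (A \in F1) || (A \in F2).
Hypothesis F1P : forall A, A \in F1 -> P \subset A.
Hypothesis F2Q : forall A, A \in F2 -> Q \subset A.
Hypothesis dPQ : [disjoint P & Q].
Hypothesis vQ : v \in Q.
Hypothesis wP : w \in P.
Hypothesis hv : P :|: Q :\ v \in F1.
Hypothesis hw : P :\ w :|: Q \in F2.
Hypothesis proper : P \notin F1 \/ Q \notin F2.

(** The condition on b1 holds because b1 is a combination of the monomials
    x^(A :\: P) with A in F1, and A = P is excluded; similarly for b2. *)
Lemma sr_ideal_split f : sr_ideal C f -> exists b1 b2,
  [/\ f = mono k P * b1 + mono k Q * b2,
      P \notin F1 -> zeroing setT b1 = 0 & Q \notin F2 -> zeroing setT b2 = 0].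
Proof.
have factor (F : {set {set 'I_m}}) (R : {set 'I_m}) (D : pred {set 'I_m}) c :
    (forall A, A \in F -> R \subset A) -> (forall A, D A -> A \in F) ->
    exists b, \sum_(A | D A) c A * mono k A = mono k R * b /\
              (R \notin F -> zeroing setT b = 0).
  move=> FR DF; exists (\sum_(A | D A) c A * mono k (A :\: R)); split.
    rewrite mulr_sumr; apply: eq_bigr => A /DF/FR RA.
    rewrite mulrCA -monoU; last by rewrite -setI_eq0 setIDA setDIl setDv set0I.
    rewrite (_ : R :|: A :\: R = A) //; apply/setP => i; rewrite !inE.
    by case: (boolP (i \in R)) => // /(subsetP RA) ->.
  move=> RF; rewrite rmorph_sum big1 // => A DA.
  rewrite rmorphM /= zeroing_mono_eq0 ?mulr0 //.
  apply: contra RF; rewrite setD_eq0 => AR.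
  have /eqP <- : A == R by rewrite eqEsubset AR FR ?DF.
  exact: DF.
move=> [c ->]; rewrite (bigID (fun A => A \in F1)) /=.
have [b1 [-> h1]] := factor F1 P (fun A => (A \notin C) && (A \in F1)) c F1P
  (fun A => fun h => proj2 (andP h)).
have [A|b2 [-> h2]] := factor F2 Q (fun A => (A \notin C) && (A \notin F1)) c F2Q.
  by rewrite nonface => /andP[/orP[->|//]].
by exists b1, b2.
Qed.

Let f1 : {mpoly k[m]} := mono k (P :\ w).
Let f2 : {mpoly k[m]} := mono k (Q :\ v).

(** The first two summands come from the two pieces of the ideal, the third from
    the relation between their generators x^P f2 and f1 x^Q. *)
Definition normal_form (y1 y2 g : koszul k m) : koszul k m :=
  kscale f1 (ku w y1) + kscale f2 (ku v y2) + kscale (f1 * f2) (ku w (ku v g)).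

(** The conditions on the constant terms make products of coefficients exact. *)
Definition normal x := exists y1 y2 g,
  [/\ x = normal_form y1 y2 g, kd y1 = 0, kd y2 = 0,
      P \notin F1 -> zeroing setT (y1 set0) = 0
    & Q \notin F2 -> zeroing setT (y2 set0) = 0].

(** Linking elements bound the products of normal cycles. *)
Definition linking x := exists c, x = normal_form 0 0 c.

Lemma f1P : 'X_w * f1 = mono k P.
Proof. by rewrite [RHS](monoD1 k wP). Qed.

Lemma f2Q : 'X_v * f2 = mono k Q.
Proof. by rewrite [RHS](monoD1 k vQ). Qed.

Lemma mono_f1Q : sr_ideal C (f1 * mono k Q).
Proof.
rewrite -[X in sr_ideal _ X]mul1r -monoU; last first.
  by apply: disjointWl dPQ; rewrite subD1set.
by apply: sr_ideal_mono; rewrite nonface hw orbT.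
Qed.

Lemma mono_f2P : sr_ideal C (mono k P * f2).
Proof.
rewrite -[X in sr_ideal _ X]mul1r -monoU; last first.
  by apply: disjointWr dPQ; rewrite subD1set.
by apply: sr_ideal_mono; rewrite nonface hv.
Qed.

(** Only the mixed terms u_w u_v and u_v u_w survive. *)
Lemma normal_form_mul y1 y2 g z1 z2 h : kmul (normal_form y1 y2 g) (normal_form z1 z2 h) =
  normal_form 0 0 (kmul (ksgn y1) z2 - kmul (ksgn y2) z1).
Proof.
rewrite /normal_form !kmulDl !raddfD /= !kmul_scalel !kmul_scaler !kmul_ku_l !kmul_ku_r.
rewrite !(ku_iji, kuu, raddf0) !(add0r, addr0) (ku_ku v w) !raddfN /=.
by rewrite !kscaleA [f2 * f1]mulrC.
Qed.

Lemma kd_normal_form y1 y2 g : kd (normal_form y1 y2 g) =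
  kscale (mono k P) y1 - kscale f1 (ku w (kd y1))
  + (kscale (mono k Q) y2 - kscale f2 (ku v (kd y2)))
  + (kscale (mono k P * f2) (ku v g) - kscale (f1 * mono k Q) (ku w g)
     + kscale (f1 * f2) (ku w (ku v (kd g)))).
Proof.
rewrite /normal_form !raddfD /= !kd_scale !kd_ku !raddfB /= !ku_scale !kscaleA.
rewrite -f1P -f2Q; congr (_ + _ + _); do ?congr (_ - _); do ?congr kscale.
- by rewrite mulrC.
- by rewrite mulrC.
by rewrite opprK addrA; congr (_ - _ + _); congr kscale; ring.
Qed.

(** The remaining terms of the differential carry the factor x_w f1 f2 or
    x_v f1 f2, which lie in the ideal. *)
Lemma kd_linking c : kideal C (kd (normal_form 0 0 c) - normal_form 0 0 (kd c)).
Proof.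
rewrite kd_normal_form /normal_form !raddf0 !(addr0, add0r) addrK.
by apply: kidealB; apply: kideal_scale; [apply: mono_f2P|apply: mono_f1Q].
Qed.

(** The cycle that multiplies f1 f2 u_w u_v has no constant term, because one of
    the two families of coefficients has none; so exactness provides c. *)
Lemma normal_mul_boundary x y : normal x -> normal y ->
  exists2 e, linking e & kideal C (kmul x y - kd e).
Proof.
move=> [y1 [y2 [g [-> dy1 dy2 e1 e2]]]] [z1 [z2 [h [-> dz1 dz2 e1' e2']]]].
set t := kmul (ksgn y1) z2 - kmul (ksgn y2) z1.
have cycle a b : kd a = 0 -> kd b = 0 -> kd (kmul (ksgn a) b) = 0.
  by move=> da db; rewrite kd_mul kd_ksgn da db !raddf0 !kmul0l addr0.
have [||c tc] := @koszul_exact _ _ t.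
- by rewrite raddfB /= !cycle // subrr.
- have const a b : kmul a b set0 = a set0 * b set0.
    rewrite kmulE (big_pred1 set0) => [|B]; last by rewrite subset0.
    rewrite setD0 /inversions (_ : [set _ | _] = set0) ?cards0 ?mul1r //.
    by apply/setP => -[i j]; rewrite !inE.
  rewrite !kE !const !ffunE cards0 !mul1r rmorphB !rmorphM /=.
  case: proper => [/[dup] /e1 -> /e1' ->|/[dup] /e2 -> /e2' ->];
  by rewrite !(mulr0, mul0r) subrr.
exists (normal_form 0 0 c); first by exists c.
by rewrite normal_form_mul -/t tc -opprB; apply/kidealN/kd_linking.
Qed.

Lemma linking_normal x : linking x -> normal x.
Proof.
move=> [c ->]; exists 0, 0, c.
by split; rewrite ?raddf0 // kE rmorph0.
Qed.

Lemma normal_linking0 x y : normal x -> linking y -> kmul x y = 0.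
Proof.
move=> [y1 [y2 [g [-> _ _ _ _]]]] [c ->].
by rewrite normal_form_mul /normal_form !(raddf0, addr0).
Qed.

Lemma linking_normal0 x y : linking x -> normal y -> kmul x y = 0.
Proof.
move=> [c ->] [y1 [y2 [g [-> _ _ _ _]]]].
by rewrite normal_form_mul /normal_form !(raddf0, kmul0l, addr0).
Qed.

Lemma kbar_normal_form y1 y2 g :
  kbar (normal_form y1 y2 g) = normal_form (ksgn y1) (ksgn y2) (kbar g).
Proof.
have kbarD x y : kbar (x + y) = kbar x + kbar y by rewrite !kbarE raddfD opprD.
have kbar_scale f x : kbar (kscale f x) = kscale f (kbar x).
  by rewrite !kbarE ksgn_scale raddfN.
by rewrite /normal_form !kbarD !kbar_scale !kbar_ku ksgn_ku kbarE !raddfN.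
Qed.

Lemma normal_kbar x : normal x -> normal (kbar x).
Proof.
move=> [y1 [y2 [g [-> dy1 dy2 e1 e2]]]].
exists (ksgn y1), (ksgn y2), (kbar g); rewrite kbar_normal_form !kd_ksgn dy1 dy2.
rewrite raddf0 oppr0; split=> //; rewrite ffunE cards0 mul1r //.
Qed.

Lemma linking_kbar x : linking x -> linking (kbar x).
Proof. by move=> [c ->]; exists (kbar c); rewrite kbar_normal_form raddf0. Qed.

Lemma linking_kpart p x : linking x -> linking (kpart p.+2 x).
Proof.
move=> [c ->]; exists (kpart p c).
by rewrite /normal_form !raddf0 !add0r kpart_scale !kpart_ku.
Qed.

(** Defining systems consist of homogeneous elements; a normal form stays normal
    when truncated to one degree. *)
Lemma normal_kpart p x : normal x -> normal (kpart p.+1 x).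
Proof.
move=> [y1 [y2 [g [-> dy1 dy2 e1 e2]]]].
have [h kh] : exists h, kpart p (ku v g) = ku v h.
  case: p => [|p]; last by exists (kpart p g); rewrite kpart_ku.
  (* u_w u_v g has no part of degree 1. *)
  exists 0; rewrite raddf0; apply/ffunP => A; rewrite kE ffunE kuE.
  by case: eqP => // /cards0_eq ->; rewrite inE.
have zeroing_kpart y : zeroing setT (y set0) = 0 -> zeroing setT (kpart p y set0) = 0.
  by rewrite ffunE; case: ifP => // _ _; rewrite rmorph0.
exists (kpart p y1), (kpart p y2), h; split.
- by rewrite /normal_form !raddfD /= !kpart_scale !kpart_ku kh.
- exact: kd_kpart_cycle.
- exact: kd_kpart_cycle.
- by move/e1/zeroing_kpart.
- by move/e2/zeroing_kpart.
Qed.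

(** The cycle g measures how far b1 and b2 are from being cycles; subtracting
    f2 u_v g from b1 and adding f1 u_w g to b2 repairs both, and the third
    summand of the normal form compensates for these corrections. *)
Lemma normal_decomposition z : kideal C (kd z) -> z set0 = 0 ->
  exists2 r, normal r & exists u, z = r + kd u.
Proof.
move=> dz z0.
have /fin_all_exists2 : forall A, exists2 b : {mpoly k[m]} * {mpoly k[m]},
    kd z A = mono k P * b.1 + mono k Q * b.2 &
    (P \notin F1 -> zeroing setT b.1 = 0) /\ (Q \notin F2 -> zeroing setT b.2 = 0).
  by move=> A; have [b1 [b2 [? ? ?]]] := sr_ideal_split (dz A); exists (b1, b2).
move=> [b bE bt].
pose b1 : koszul k m := [ffun A : {set 'I_m} => (b A).1].
pose b2 : koszul k m := [ffun A : {set 'I_m} => (b A).2].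
have dzE : kd z = kscale (mono k P) b1 + kscale (mono k Q) b2.
  by apply/ffunP => A; rewrite bE kE !ffunE.
have ddz : kscale (mono k P) (kd b1) + kscale (mono k Q) (kd b2) = 0.
  by rewrite -(kdd z) dzE raddfD /= !kd_scale.
have /fin_all_exists[g' g'E] : forall A, exists h, kd b1 A = mono k Q * h.
  move=> A; apply: (mono_coprime (g := - kd b2 A) dPQ).
  move/ffunP/(_ A): ddz; rewrite !kE ![kscale _ _ _]ffunE => /eqP.
  by rewrite addr_eq0 mulrN => /eqP.
pose g : koszul k m := [ffun A : {set 'I_m} => g' A].
have db1 : kd b1 = kscale (mono k Q) g by apply/ffunP => A; rewrite g'E !ffunE.
have QI := kscaleI (mono_neq0 k Q).
have db2 : kd b2 = - kscale (mono k P) g.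
  apply: QI; apply/eqP; rewrite raddfN /= -addr_eq0 addrC.
  by rewrite kscaleC -db1 ddz.
have dg : kd g = 0.
  by apply: QI; rewrite -kd_scale -db1 kdd raddf0.
pose y1 := b1 - kscale f2 (ku v g).
pose y2 := b2 + kscale f1 (ku w g).
have dy1 : kd y1 = 0.
  by rewrite raddfB /= kd_scale kd_ku dg !(raddf0, addr0) kscaleA mulrC f2Q db1 subrr.
have dy2 : kd y2 = 0.
  by rewrite raddfD /= kd_scale kd_ku dg !(raddf0, addr0) kscaleA mulrC f1P db2 addNr.
have dr : kd (normal_form y1 y2 g) = kd z.
  rewrite kd_normal_form dy1 dy2 dg !(raddf0, addr0) /y1 /y2 raddfB raddfD /= !kscaleA.
  by rewrite dzE [f1 * _]mulrC; apply/ffunP => A; rewrite !kE; ring.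
exists (normal_form y1 y2 g).
  exists y1, y2, g; split=> // h.
    by rewrite !(kE, ffunE) inE mulr0 subr0; apply: (bt _).1.
  by rewrite !(kE, ffunE) inE mulr0 addr0; apply: (bt _).2.
have [||u zu] := @koszul_exact _ _ (z - normal_form y1 y2 g).
- by rewrite raddfB /= dr subrr.
- by rewrite !(kE, ffunE) z0 !inE !mulr0 !addr0 subrr rmorph0.
by exists u; rewrite -zu addrC subrK.
Qed.

Lemma normal_representative p x : (0 < p)%N -> khomog C p x -> kcycle C x ->
  exists r u, [/\ normal r, kpart p r = r & kideal C (x - (r + kd u))].
Proof.
move=> p0 /khomog_kpart hx /keqP; rewrite subr0 => dx.
have [||r sr [u e]] := @normal_decomposition (kpart p x).
- rewrite -[kpart p x](subKr x) raddfB /=; apply: kidealB => //.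
  exact: kideal_kd.
- by rewrite ffunE cards0 eq_sym eqn0Ngt p0.
exists (kpart p r), (kpart p.+1 u); split; last first.
- by rewrite kd_kpart -[kpart p r + _]raddfD /= -e kpartK.
- exact: kpartK.
- by move: sr; case: p {hx e} p0 => // p _; apply: normal_kpart.
Qed.

Lemma kcycle_normal z r u :
  kcycle C z -> kideal C (z - (r + kd u)) -> kideal C (kd r).
Proof.
move=> /keqP; rewrite subr0 => dz /kideal_kd; rewrite raddfB raddfD /= kdd addr0.
by move=> h; rewrite -(subKr (kd z) (kd r)); apply: kidealB.
Qed.

(** Writing x = r1 + d u1 and y = r2 + d u2 modulo the ideal, the Leibniz rule
    reduces the claim to the product of the normal representatives. *)
Lemma glue_product p q x y : (0 < p)%N -> (0 < q)%N ->
  khomog C p x -> khomog C q y -> kcycle C x -> kcycle C y ->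
  homologous C (kmul x y) 0.
Proof.
move=> p0 q0 hx hy dx dy.
have [r1 [u1 [s1 _ e1]]] := normal_representative p0 hx dx.
have [r2 [u2 [s2 _ e2]]] := normal_representative q0 hy dy.
have dr1 := kcycle_normal dx e1; have dr2 := kcycle_normal dy e2.
have [e _ he] := normal_mul_boundary s1 s2.
exists (e + kmul (ksgn r1) u2 + kmul u1 (r2 + kd u2)); apply/keqP; rewrite subr0.
have -> : kmul x y = kmul (x - (r1 + kd u1)) y +
    kmul (r1 + kd u1) (y - (r2 + kd u2)) + kmul (r1 + kd u1) (r2 + kd u2).
  by rewrite -addrA -raddfD /= subrK -kmulDl subrK.
rewrite -2!addrA; apply: kidealD; first exact: kideal_mull.
apply: kidealD; first exact: kideal_mulr.
rewrite [X in kideal C X](_ : _ = kmul r1 r2 - kd e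
    - kmul (kd (ksgn r1)) u2 - kmul (ksgn u1) (kd r2)); last first.
  rewrite !raddfD /= !kd_mul ksgnK !kmulDl !raddfD /= kdd raddf0.
  by apply/ffunP => A; rewrite !kE; ring.
apply: kidealB; last exact: kideal_mulr.
by apply: kidealB => //; rewrite kd_ksgn; apply/kideal_mull/kidealN/kideal_ksgn.
Qed.

Lemma choose_upto (n : nat) (R : nat -> koszul k m -> Prop) :
  (forall i, (1 <= i <= n)%N -> exists x, R i x) ->
  exists F, forall i, (1 <= i <= n)%N -> R i (F i).
Proof.
elim: n => [|n IH] hR; first by exists (fun=> 0) => -[].
have [i hi|F hF] := IH.
  by apply: hR; case/andP: hi => -> /leqW.
have [x hx] := hR n.+1 (leqnn _).
exists (fun i => if i == n.+1 then x else F i) => i /andP[i0 le_in].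
case: eqP => [->//|/eqP ne]; apply: hF; rewrite i0 -ltnS ltn_neqAle ne.
exact: le_in.
Qed.

(** The defining system has linking elements just above the diagonal and 0
    beyond; repeated factors u_v or u_w make every longer product vanish. *)
Lemma glue_massey n (p : nat -> nat) (z : nat -> koszul k m) : (3 <= n)%N ->
  (forall i, (1 <= i <= n)%N ->
     [/\ (0 < p i)%N, khomog C (p i) (z i) & kcycle C (z i)]) ->
  in_massey C n p z 0.
Proof.
move=> n3 hz.
have [i hi|r hr] := @choose_upto n (fun i x => [/\ normal x, kpart (p i) x = x,
   homologous C x (z i) & kcycle C x]).
  have [p0 hzi dz] := hz i hi; have [r [u [sr pr e]]] := normal_representative p0 hzi dz.
  exists r; split=> //.
    exists (- u); apply/keqP.
    rewrite (_ : r - z i - _ = - (z i - (r + kd u))); first exact: kidealN.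
    by rewrite raddfN; apply/ffunP => A; rewrite !kE; ring.
  by apply/keqP; rewrite subr0; apply: kcycle_normal e.
have [i hi|e he] := @choose_upto n.-1 (fun i x => [/\ linking x,
   kpart (p i + p i.+1).+1 x = x & kideal C (kd x - kmul (kbar (r i)) (r i.+1))]).
  have [i0 le_in] := andP hi.
  have lt_in : (i < n)%N by rewrite -(ltn_predK n3) ltnS.
  have [|s1 k1 _ _] := hr i; first by rewrite i0 ltnW.
  have [|s2 k2 _ _] := hr i.+1; first by rewrite lt_in.
  have [y ly hy] := normal_mul_boundary (normal_kbar s1) s2.
  have [|p1 _ _] := hz i; first by rewrite i0 ltnW.
  exists (kpart (p i + p i.+1).+1 y); split; last first.
  - have km : kpart (p i + p i.+1) (kmul (kbar (r i)) (r i.+1))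
      = kmul (kbar (r i)) (r i.+1) by rewrite -k1 -k2 kbar_kpart kmul_kpart.
    rewrite kd_kpart -km -[_ - _]raddfB /=.
    by apply: kideal_kpart; rewrite -opprB; apply: kidealN.
  - exact: kpartK.
  - by rewrite -(prednK p1) addSn; apply: linking_kpart.
pose a i j := if j == i then r i else if j == i.+1 then e i else 0.
have aii i : a i i = r i by rewrite /a eqxx.
have ai1 i : a i i.+1 = e i by rewrite /a eqxx gtn_eqF.
have link i j : (1 <= i)%N -> (i < j)%N -> (j <= n)%N -> linking (a i j).
  move=> i0 ij jn; rewrite /a gtn_eqF //; case: eqP => [ej|_].
    have [] // := he i; rewrite i0 -ltnS (ltn_predK n3).
    by apply: leq_trans jn; rewrite ej.
  by exists 0; rewrite /normal_form !(raddf0, addr0).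
have spec i j : (1 <= i)%N -> (i <= j)%N -> (j <= n)%N -> normal (a i j).
  move=> i0; rewrite leq_eqVlt => /orP[/eqP <- jn|ij jn].
    by rewrite aii; have [] := hr i; rewrite ?i0.
  exact/linking_normal/link.
(* At distance at least 2, one factor of every summand lies off the diagonal. *)
have term0 i j : (1 <= i)%N -> (i.+1 < j)%N -> (j <= n)%N -> massey_term a i j = 0.
  move=> i0 ij jn; rewrite /massey_term big_nat_cond big1 // => l.
  rewrite andbT => /andP[il lj]; have [eil|lt_il] := eqVneq i l.
    apply: normal_linking0; first by apply/normal_kbar/spec => //; lia.
    by apply: link => //; lia.
  apply: linking_normal0; first by apply/linking_kbar/link; lia.
  by apply: spec; lia.
exists a; last first.
  by exists 0; apply/keqP; rewrite term0 // !(raddf0, subr0); apply: kideal0.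
split.
- by move=> i hi; rewrite aii; have [] := hr i hi.
- move=> i j i0; rewrite leq_eqVlt => /orP[/eqP <- jn _|ij jn _].
    have [|_ k1 _ _] := hr i; first by rewrite i0.
    rewrite aii big_nat1 subnn addn0; apply/khomog_kpart.
    by rewrite k1 subrr; apply: kideal0.
  rewrite /a gtn_eqF //; case: eqP => [ej|_]; last first.
    by apply/khomog_kpart; rewrite raddf0 subr0; apply: kideal0.
  have [|_ k1 _] := he i; first by lia.
  rewrite ej big_nat_recr ?big_nat1 /=; last by lia.
  rewrite (_ : (i.+1 - i)%N = 1%N); last by lia.
  by apply/khomog_kpart; rewrite addn1 k1 subrr; apply: kideal0.
- by move=> i hi; rewrite aii; have [] := hr i hi.
- move=> i j i0 ij jn _; have [ej|nej] := eqVneq j i.+1.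
    have [|_ _ h] := he i; first by lia.
    by apply/keqP; rewrite ej ai1 /massey_term big_nat1 !aii.
  rewrite term0 //; last by lia.
  apply/keqP; rewrite subr0 /a gtn_eqF // (negPf nej) raddf0; exact: kideal0.
Qed.

Lemma golod_over_glue : golod_over k C.
Proof. by split; [apply: glue_product|apply: glue_massey]. Qed.

End Glue.

(** * Faces of the dual *)

Section Combinatorics.
Variables (T : finType).
Implicit Types (U V A s : {set T}) (K : {set {set T}}).

Lemma not_facet_extend V K s : simplicial_complex V K -> s \in K ->
  ~~ facet K s -> exists x, [/\ x \in V, x \notin s & x |: s \in K].
Proof.
move=> [_ KV Ks] sK nf.
have [t tmax st] := maxset_exists (P := fun t => t \in K) sK.
have : ~~ (t \subset s).
  apply: contra nf => ts; rewrite (_ : s = t) //.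
  by apply/eqP; rewrite eqEsubset st.
case/subsetPn => x xt xs; exists x.
have tK : t \in K by case/maxsetP: tmax.
split=> //; first exact: (subsetP (KV _ tK)).
by apply: (Ks t) => //; rewrite subUset sub1set xt.
Qed.

Lemma full_simplexP V K : simplicial_complex V K -> V \in K ->
  K = full_simplex V.
Proof.
move=> [_ KV Ks] VK; apply/setP => s; rewrite inE.
by apply/idP/idP => [/KV//|sV]; apply: Ks sV.
Qed.

(** This is where Alexander duality enters: the nonfaces of the dual are the
    complements of the faces. *)
Lemma relabel_dual U K (s : {set 'I_#|U|}) :
  (s \notin relabel U (alexander_dual U K)) =
  (U :\: [set enum_val i | i in s] \in K).
Proof.
rewrite !inE; set t := imset _ _.
suff -> : t \subset U by rewrite negbK.
by apply/subsetP => _ /imsetP[i _ ->]; apply: enum_valP.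
Qed.

(** Transport along [enum_val], in the form in which faces are recognized from
    the complementary sets of indices. *)
Lemma setD_relabel U A (s : {set 'I_#|U|}) : A \subset U ->
  (forall i, (i \in s) = (enum_val i \notin A)) ->
  U :\: [set enum_val i | i in s] = A.
Proof.
move=> /subsetP AU sA; apply/setP => x; rewrite inE.
case: (boolP (x \in U)) => [xU|xU]; last first.
  by rewrite andbF; apply/esym; apply: contraNF xU => /AU.
rewrite andbT -(enum_rankK_in xU xU) mem_imset; last exact: enum_val_inj.
by rewrite sA negbK.
Qed.

End Combinatorics.

Theorem corollary2p6 (T : finType) (V W : {set T}) (K L : {set {set T}})
    (alpha : {set T})
    (hK : simplicial_complex V K) (hL : simplicial_complex W L)
    (dimK : 0 <= complex_dim K) (dimL : 0 <= complex_dim L)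
    (halpha : alpha = V :&: W) (alphaK : alpha \in K) (alphaL : alpha \in L)
    (hKL : K <> full_simplex V \/ L <> full_simplex W)
    (nfacetK : ~~ facet K alpha) (nfacetL : ~~ facet L alpha) :
  golod (V :|: W) (alexander_dual (V :|: W) (K :|: L)).
Proof.
move=> k; set U := V :|: W.
have [a [aV aN aK]] := not_facet_extend hK alphaK nfacetK.
have [b [bW bN bL]] := not_facet_extend hL alphaL nfacetL.
have rank x : x \in U -> exists i : 'I_#|U|, enum_val i = x.
  by move=> xU; exists (enum_rank_in xU x); rewrite enum_rankK_in.
have [|v va] := rank a; first by rewrite inE aV.
have [|w wb] := rank b; first by rewrite inE bW orbT.
have aW : a \notin W by apply: contra aN => aW; rewrite halpha inE aV.
have bV : b \notin V by apply: contra bN => bV; rewrite halpha inE bW bV.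
have [_ KV _] := hK; have [_ LW _] := hL.
pose nonfaces (M : {set {set T}}) :=
  [set s : {set 'I_#|U|} | U :\: [set enum_val i | i in s] \in M].
pose restr (A : {set T}) := [set i : 'I_#|U| | enum_val i \in A].
have valU (i : 'I_#|U|) : (enum_val i \in V) || (enum_val i \in W).
  by have := enum_valP i; rewrite inE.
have aE i : (i == v) = (enum_val i == a) by rewrite -va (inj_eq enum_val_inj).
have bE i : (i == w) = (enum_val i == b) by rewrite -wb (inj_eq enum_val_inj).
have cover (M : {set {set T}}) (X Y : {set T}) s :
    (forall t, t \in M -> t \subset X) ->
    s \in nonfaces M -> restr (Y :\: X) \subset s.
  rewrite inE => MX /MX/subsetP h; apply/subsetP => i; rewrite !inE => /andP[iX _].
  apply: contraNT iX => si; apply: h; rewrite inE enum_valP andbT.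
  by rewrite mem_imset //; apply: enum_val_inj.
apply: (@golod_over_glue _ _ _ (nonfaces K) (nonfaces L)
  (restr (W :\: V)) (restr (V :\: W)) v w).
- by move=> s; rewrite relabel_dual !inE.
- by move=> s; apply: cover.
- by move=> s; apply: cover.
- rewrite -setI_eq0; apply/eqP/setP => i; rewrite !inE.
  by case: (_ \in V); rewrite ?andbF.
- by rewrite !inE va aV aW.
- by rewrite !inE wb bW bV.
- rewrite inE (@setD_relabel _ _ (a |: alpha)) // => [|i].
    by rewrite subUset sub1set !inE aV halpha subIset // subsetUl.
  rewrite !inE aE negb_or halpha inE; have := valU i.
  by case: eqP => [->|_]; rewrite ?aV ?(negPf aW) //=; do 2!case: (_ \in _).
- rewrite inE (@setD_relabel _ _ (b |: alpha)) // => [|i].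
    by rewrite subUset sub1set !inE bW orbT halpha subIset // subsetUl.
  rewrite !inE bE negb_or halpha inE; have := valU i.
  by case: eqP => [->|_]; rewrite ?bW ?(negPf bV) //=; do 2!case: (_ \in _).
- have full (X Y : {set T}) M : X \subset U ->
    (forall i : 'I_#|U|, (enum_val i \in X) || (enum_val i \in Y)) ->
    simplicial_complex X M -> M <> full_simplex X ->
    restr (Y :\: X) \notin nonfaces M.
    move=> XU XY hM nM; rewrite inE (@setD_relabel _ _ X) // => [|i].
      by apply/negP => /(full_simplexP hM).
    by rewrite !inE; have := XY i; do 2!case: (_ \in _).
  case: hKL => [nK|nL]; [left|right]; apply: full => //.
  + exact: subsetUl.
  + exact: subsetUr.
  + by move=> i; rewrite orbC.
Qed.
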